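(* Let $F:\mathbb{R}^2\to\mathbb{R}^2$ be a nonlinear polynomial map such that $F(0)=0$ and, for all $(x,y)\in\mathbb{R}^2$, all the (complex) eigenvalues of the Jacobian matrix $JF(x,y)$ have modulus less than one. Let $\Gamma$ be the symmetry group of $F$, and suppose that $\Gamma$ is a nontrivial compact Lie group. Then $\Gamma=\mathbb{Z}_2$, i.e. $\Gamma$ is a group of order two.
   Context: Polynomial map: both coordinate functions are real polynomials in $(x,y)$; nonlinear means not a linear map. Compact Lie groups acting on $\mathbb{R}^2$ are regarded as compact subgroups of $GL(2,\mathbb{R})$ acting linearly. Saying that the compact Lie group $\Gamma$ is the symmetry group of $F$ means that $F(\gamma\cdot(x,y))=\gamma\cdot F(x,y)$ for all $(x,y)\in\mathbb{R}^2$ and all $\gamma\in\Gamma$, and that $\Gamma$ is the largest such group, in the sense that no strictly larger compact subgroup of $GL(2,\mathbb{R})$ has this property. Here $\mathbb{Z}_2$ denotes a group of order two (as an abstract group; it may be generated by minus the identity or by a reflection). *)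

(* Defs.v *)
From HB Require Import structures.
From mathcomp Require Import all_boot all_order all_algebra.
From mathcomp Require Import complex.
From mathcomp Require Import all_classical all_reals all_analysis.

Set Implicit Arguments.
Unset Strict Implicit.
Unset Printing Implicit Defensive.

Import Order.TTheory GRing.Theory Num.Theory.
Import numFieldNormedType.Exports.

Local Open Scope classical_set_scope.
Local Open Scope ring_scope.

(* Points of R^2 are row vectors (x, y) = (v 0 0, v 0 1), as required by the   *)
(* library's [jacobian].  A bivariate polynomial p is an element of            *)
(* {poly {poly R}}, and p.[x%:P].[y] is its value at (x, y), as in polyXY.     *)
Definition polynomial_map (R : realType) (F : 'rV[R]_2 -> 'rV[R]_2) : Prop :=
  exists p : 'I_2 -> {poly {poly R}},
    forall v i, F v 0 i = (p i).[(v 0 0)%:P].[v 0 1].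

(* [jacobian F v] is the matrix J with 'd F v w = w *m J, i.e. the transpose   *)
(* of the matrix of partial derivatives; the row eigenvectors of [eigenvalue]  *)
(* are thus the eigenvectors of the differential of F at v.                    *)
Definition jacobian_eigenvalues_lt1 (R : realType)
    (F : 'rV[R]_2 -> 'rV[R]_2) : Prop :=
  forall (v : 'rV[R]_2) (z : complex R),
    eigenvalue (map_mx (real_complex R) (jacobian F v)) z -> `|z| < 1.

Definition GL2_subgroup (R : realType) (G : set 'M[R]_2) : Prop :=
  [/\ G `<=` [set g | g \in unitmx],
      G 1%:M,
      forall g h, G g -> G h -> G (g *m h) &
      forall g, G g -> G (invmx g)].

(* The transpose of g *m v^T: the usual left action of g on column vectors.    *)
Definition mxact (R : realType) (g : 'M[R]_2) (v : 'rV[R]_2) : 'rV[R]_2 :=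
  v *m g^T.

Definition equivariant (R : realType) (F : 'rV[R]_2 -> 'rV[R]_2)
    (G : set 'M[R]_2) : Prop :=
  forall g, G g -> forall v, F (mxact g v) = mxact g (F v).

(* Compactness of a subset of GL(2, R) is the same in GL(2, R) and in 'M_2.    *)
Definition compact_symmetries (R : realType) (F : 'rV[R]_2 -> 'rV[R]_2)
    (G : set 'M[R]_2) : Prop :=
  [/\ GL2_subgroup G, compact G & equivariant F G].

Definition symmetry_group (R : realType) (F : 'rV[R]_2 -> 'rV[R]_2)
    (G : set 'M[R]_2) : Prop :=
  compact_symmetries F G /\
  forall H, compact_symmetries F H -> G `<=` H -> H = G.

(* Main.v *)
(* Let H be the homogeneous part of F of top degree n >= 2.  The trace and the
   determinant of JF are bounded, hence constant along every ray, so JH has zero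
   trace and zero determinant.  With y = 1 this gives two univariate polynomials
   with zero Wronskian, and H(v) = c * l(v)^n * w follows, where l is a linear
   form that vanishes on w.  A symmetry g of F is a symmetry of H, so w is an
   eigenvector of g and l(g v) = nu(g) * l(v), the eigenvalue at w being nu(g)^n.
   The powers of g are bounded, so nu(g) = 1 or -1, and nu(g) = 1 forces g = 1
   (g would otherwise be a nontrivial shear).  Thus nu embeds G in {1, -1}. *)

Require Import Defs.
From mathcomp Require Import all_boot all_order all_algebra.
From mathcomp Require Import complex polyrcf polyorder.
From mathcomp Require Import ring lra.
From mathcomp Require Import all_classical all_reals all_analysis.
Import Order.TTheory GRing.Theory Num.Theory.
Import numFieldNormedType.Exports.
Local Open Scope classical_set_scope.
Local Open Scope ring_scope.

Set Implicit Arguments.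
Unset Strict Implicit.
Unset Printing Implicit Defensive.

(** * Univariate polynomials *)

Lemma poly_ext (R : numFieldType) (p q : {poly R}) :
  (forall x, p.[x] = q.[x]) -> p = q.
Proof.
move=> pq; apply/eqP; rewrite -subr_eq0; apply/eqP.
(* The natural numbers are distinct in characteristic zero, so the difference has more roots than
   its degree allows. *)
pose s : seq R := [seq i%:R | i <- iota 0 (size (p - q))].
apply: (@roots_geq_poly_eq0 _ _ s); last by rewrite size_map size_iota.
  by apply/allP => x _; rewrite /root !hornerE pq subrr.
by rewrite map_inj_uniq ?iota_uniq// => i j /eqP; rewrite eqr_nat => /eqP.
Qed.

(** After a change of sign the leading coefficient is positive. If p were nonconstant, p - M would
    share this coefficient and be eventually positive. *)
Lemma bounded_poly_size (R : realFieldType) (p : {poly R}) (M : R) :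
  (forall x, `|p.[x]| <= M) -> (size p <= 1)%N.
Proof.
wlog p0 : p / 0 < lead_coef p => [th|] pM.
  have [|p0|/esym/eqP] := ltgtP 0 (lead_coef p); first by move/th; apply.
    by rewrite -size_polyN th ?lead_coefN ?oppr_gt0// => x; rewrite hornerN normrN.
  by rewrite lead_coef_eq0 => /eqP ->; rewrite size_poly0.
rewrite leqNgt; apply/negP => s1.
have lq : lead_coef (p - M%:P) = lead_coef p.
  by rewrite lead_coefDl// size_polyN (leq_ltn_trans (size_polyC_leq1 _)).
have [|n] := @poly_pinfty_gt_lc _ (p - M%:P); first by rewrite lq.
move=> /(_ n (lexx _)); rewrite lq !hornerE leNgt => /negP; apply.
rewrite (le_lt_trans _ p0)// subr_le0.
exact: le_trans (ler_norm _) (pM n).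
Qed.

Lemma lead_coef_deriv (R : realDomainType) (p : {poly R}) :
  lead_coef p^`() = lead_coef p *+ (size p).-1.
Proof.
have [p1|p1] := leqP (size p) 1.
  have -> : (size p).-1 = 0%N by apply/eqP; rewrite -leqn0 -subn1 leq_subLR.
  by rewrite (size1_polyC p1) derivC lead_coef0.
by rewrite /lead_coef size_deriv coef_deriv -subn2 -subSn// subn2.
Qed.

(** The hypothesis is (p/q)' = 0. Comparing leading coefficients in characteristic zero forces equal
    degrees for nonzero p; subtracting the multiple of q that cancels the leading term keeps the
    identity and lowers the size. *)
Lemma wronskian_eq0 (R : realFieldType) (p q : {poly R}) :
  q != 0 -> p^`() * q = p * q^`() -> exists a, p = a *: q.
Proof.
move=> q0; have [n] := ubnP (size p); elim: n p => // n IH p; rewrite ltnS => pn w.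
have [->|p0] := eqVneq p 0; first by exists 0; rewrite scale0r.
have lq0 : lead_coef q != 0 by rewrite lead_coef_eq0.
have lp0 : lead_coef p != 0 by rewrite lead_coef_eq0.
have spq : size p = size q.
  move: (congr1 (@lead_coef _) w); rewrite !lead_coefM !lead_coef_deriv.
  rewrite mulrnAl mulrnAr -mulr_natl -[RHS]mulr_natl.
  move=> /(mulIf (mulf_neq0 lp0 lq0))/eqP; rewrite eqr_nat => /eqP e.
  by rewrite (polySpred p0) e -(polySpred q0).
pose a := lead_coef p / lead_coef q.
have [||b pb] := IH (p - a *: q).
- apply: leq_trans pn; rewrite (polySpred p0) ltnS; apply/leq_sizeP => j.
  rewrite leq_eqVlt => /orP[/eqP<-|pj].
    by rewrite coefB coefZ {2}spq -!lead_coefE /a divfK// subrr.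
  have {}pj : (size p <= j)%N := leq_trans (leqSpred _) pj.
  by rewrite coefB coefZ !nth_default -?spq// mulr0 subrr.
- by rewrite derivB derivZ !mulrBl w -!scalerAl [q^`() * q]mulrC.
by exists (a + b); rewrite scalerDl -pb addrC subrK.
Qed.

(** * Homogeneous parts of bivariate polynomials *)

(** The outer variable is x, and the coefficients are polynomials in y. *)
Definition homog_part (R : comNzRingType) (p : {poly {poly R}}) (k : nat)
    (x y : R) : R :=
  \sum_(j < k.+1) p`_j`_(k - j) * x ^+ j * y ^+ (k - j).

(** This is p(tx, ty) as a polynomial in t; its coefficients are the homogeneous parts of p at (x,
    y). *)
Definition ray_poly (R : comNzRingType) (p : {poly {poly R}}) (x y : R) :
    {poly R} :=
  (map_poly (comp_poly (y *: 'X)) p).[x *: 'X].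

Lemma horner_ray (R : comNzRingType) (p : {poly {poly R}}) (x y t : R) :
  (ray_poly p x y).[t] = p.[(t * x)%:P].[t * y].
Proof.
rewrite /ray_poly; elim/poly_ind: p => [|p c IH].
  by rewrite rmorph0 !hornerE.
rewrite rmorphD rmorphM /= map_polyX map_polyC /= !hornerE IH horner_comp.
by rewrite !hornerE /= mulrAC [y * t]mulrC.
Qed.

Lemma coef_comp_scaleX (R : comNzRingType) (p : {poly R}) (a : R) (k : nat) :
  (p \Po (a *: 'X))`_k = p`_k * a ^+ k.
Proof.
have -> : p \Po (a *: 'X) = \poly_(i < size p) (p`_i * a ^+ i).
  rewrite comp_polyE poly_def; apply: eq_bigr => i _.
  by rewrite exprZn scalerA.
by rewrite coef_poly; case: ltnP => // kp; rewrite nth_default ?mul0r.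
Qed.

Lemma coef_ray (R : comNzRingType) (p : {poly {poly R}}) (x y : R) (k : nat) :
  (ray_poly p x y)`_k = homog_part p k x y.
Proof.
rewrite /ray_poly; elim/poly_ind: p k => [|p c IH] k.
  rewrite rmorph0 horner0 coef0 /homog_part big1// => i _.
  by rewrite !coef0 !mul0r.
rewrite rmorphD rmorphM /= map_polyX map_polyC /= !hornerE.
rewrite coefD coef_comp_scaleX -scalerAr coefZ coefMX /homog_part.
rewrite big_ord_recl subn0 expr0 mulr1 coefD coefMX add0r coefC /=.
case: k => [|k] /=; first by rewrite big_ord0 mulr0 addr0 add0r.
rewrite addrC IH; congr (_ + _); rewrite mulr_sumr; apply: eq_bigr => i _.
by rewrite !coefE /= addr0 subSS exprS; ring.
Qed.

Lemma homog_part_deriv_fst (R : comNzRingType) (p : {poly {poly R}}) k (x : R) :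
  homog_part p^`() k x 1 = (\poly_(j < k.+2) p`_j`_(k.+1 - j))^`().[x].
Proof.
rewrite /homog_part (@horner_coef_wide _ k.+1); last first.
  apply/leq_sizeP => j kj; rewrite coef_deriv coef_poly ltnS ltnNge kj.
  by rewrite mul0rn.
apply: eq_bigr => j _; rewrite !coef_deriv coef_poly ltnS ltn_ord subSS.
by rewrite coefMn expr1n mulr1.
Qed.

(** Euler's identity $x H_x + y H_y = (k+1) H$ at y = 1, where H is the part of degree k + 1 and
    a(x) = H(x, 1). *)
Lemma homog_part_deriv_snd (R : comNzRingType) (p : {poly {poly R}}) k (x : R) :
  let a := \poly_(j < k.+2) p`_j`_(k.+1 - j) in
  homog_part (map_poly (@deriv R) p) k x 1 = k.+1%:R * a.[x] - x * a^`().[x].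
Proof.
move=> a; rewrite /a -homog_part_deriv_fst /homog_part horner_poly.
have -> : x * (\sum_(j < k.+1) p^`()`_j`_(k - j) * x ^+ j * 1 ^+ (k - j)) =
    \sum_(j < k.+2) (p`_j`_(k.+1 - j) * x ^+ j) *+ j.
  rewrite [RHS]big_ord_recl mulr0n add0r mulr_sumr; apply: eq_bigr => j _.
  by rewrite coef_deriv coefMn expr1n /= subSS exprS mulr1 mulrnAl mulrnAr mulrCA.
rewrite mulr_natl -sumrMnl -sumrB [RHS]big_ord_recr /= subrr addr0.
apply: eq_bigr => j _; rewrite coef_map_id0 ?linear0// coef_deriv expr1n.
rewrite -mulrnBr; last exact: (ltnW (ltn_ord (widen_ord _ j))).
by rewrite mulr1 mulrnAl subSn -1?ltnS.
Qed.

(** * Jacobians *)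

Section PolynomialMapDifferential.
Variable R : realType.

Lemma is_diff_coord (m n : nat) (M : 'M[R]_(m, n)) i j :
  is_diff M (fun N : 'M[R]_(m, n) => N i j : R) (fun N => N i j).
Proof.
have @f : {linear 'M[R]_(m, n) -> R}.
  by exists (fun N : 'M[R]_(_, _) => N i j); do 2![eexists]; do ?[constructor];
     rewrite ?mxE// => ? *; rewrite ?mxE//; move=> ?; rewrite !mxE.
apply: DiffDef; first exact: differentiable_coord.
rewrite (_ : (fun N : 'M[R]_(m, n) => N i j) = f)//.
exact/diff_lin/coord_continuous.
Qed.

Lemma is_diff_horner_coord (p : {poly R}) (v : 'rV[R]_2) :
  is_diff v (fun u : 'rV[R]_2 => p.[u 0 1] : R)
    (fun w => w 0 1 * p^`().[v 0 1]).
Proof.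
elim/poly_ind: p => [|p c IH].
  rewrite (_ : (fun _ => _) = cst 0); last by apply/funext => u; rewrite horner0.
  by apply: is_diff_eq; apply/funext => w /=; rewrite deriv0 horner0 mulr0.
rewrite (_ : (fun _ => _) =
    (fun u : 'rV[R]_2 => p.[u 0 1]) * (fun u => u 0 1) + cst c); last first.
  by apply/funext => u; rewrite !hornerE.
have H := is_diff_coord v 0 1.
apply: is_diff_eq; apply/funext => w; rewrite !fctE !poly.derivE !hornerE.
rewrite /GRing.scale/=. ring.
Qed.

(** Horner induction in the outer variable x; the coefficientwise derivative is the partial
    derivative in y. *)
Lemma is_diff_poly2 (p : {poly {poly R}}) (v : 'rV[R]_2) :
  is_diff v (fun u : 'rV[R]_2 => p.[(u 0 0)%:P].[u 0 1] : R)
    (fun w => w 0 0 * p^`().[(v 0 0)%:P].[v 0 1] +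
              w 0 1 * (map_poly (@deriv R) p).[(v 0 0)%:P].[v 0 1]).
Proof.
elim/poly_ind: p => [|p c IH].
  rewrite (_ : (fun _ => _) = cst 0); last by apply/funext => u; rewrite !horner0.
  apply: is_diff_eq; apply/funext => w /=.
  by rewrite deriv0 map_poly0 !horner0 !mulr0 addr0.
have Hc := is_diff_horner_coord c v.
rewrite (_ : (fun _ => _) =
    (fun u : 'rV[R]_2 => p.[(u 0 0)%:P].[u 0 1]) * (fun u => u 0 0) +
    (fun u : 'rV[R]_2 => c.[u 0 1])); last first.
  by apply/funext => u; rewrite !hornerE.
have H := is_diff_coord v 0 0.
apply: is_diff_eq; apply/funext => w; rewrite !fctE !poly.derivE.
have -> : map_poly (@deriv R) (p * 'X + c%:P) =
    map_poly (@deriv R) p * 'X + (c^`())%:P.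
  apply/polyP => i; rewrite coef_map_id0 ?linear0// !coefD !coefMX !coefC.
  by rewrite derivD coef_map_id0 ?linear0//; case: i => [|i]; rewrite /= ?linear0.
rewrite !hornerE /GRing.scale/=. ring.
Qed.

Variables (F : 'rV[R]_2 -> 'rV[R]_2) (p : 'I_2 -> {poly {poly R}}).
Hypothesis Fp : forall v i, F v 0 i = (p i).[(v 0 0)%:P].[v 0 1].

Lemma differentiable_polynomial_map (v : 'rV[R]_2) : differentiable F v.
Proof.
rewrite (_ : F = \sum_(i < 2) (fun u => F u 0 i *: delta_mx 0 i)); last first.
  by apply/funext => u; rewrite fct_sumE {1}[F u]row_sum_delta.
apply: differentiable_sum => i; apply: differentiableZl.
have [+ _] := is_diff_poly2 (p i) v.
by under eq_fun do rewrite -Fp.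
Qed.

Lemma diff_polynomial_map (v w : 'rV[R]_2) i :
  'd F v w 0 i = w 0 0 * (p i)^`().[(v 0 0)%:P].[v 0 1] +
                 w 0 1 * (map_poly (@deriv R) (p i)).[(v 0 0)%:P].[v 0 1].
Proof.
have /differentiableP dF := differentiable_polynomial_map v.
have H := is_diff_coord (F v) 0 i.
have E : (fun N : 'rV[R]_2 => N 0 i : R) \o F =
    fun u => (p i).[(u 0 0)%:P].[u 0 1] by apply/funext => u; exact: Fp.
have [_] := is_diff_comp dF H; rewrite E.
have [_ ->] := is_diff_poly2 (p i) v.
by move=> /(congr1 (fun f => f w)).
Qed.

Lemma jacobian_polynomial_map_fst (v : 'rV[R]_2) i :
  jacobian F v 0 i = (p i)^`().[(v 0 0)%:P].[v 0 1].
Proof.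
by rewrite /jacobian /lin1_mx mxE diff_polynomial_map !mxE /= mul1r mul0r addr0.
Qed.

Lemma jacobian_polynomial_map_snd (v : 'rV[R]_2) i :
  jacobian F v 1 i = (map_poly (@deriv R) (p i)).[(v 0 0)%:P].[v 0 1].
Proof.
by rewrite /jacobian /lin1_mx mxE diff_polynomial_map !mxE /= mul1r mul0r add0r.
Qed.

End PolynomialMapDifferential.

Lemma det_mx22 (R : comPzRingType) (M : 'M[R]_2) :
  \det M = M 0 0 * M 1 1 - M 0 1 * M 1 0.
Proof.
rewrite (expand_det_row _ 0) !big_ord_recl big_ord0 /cofactor !det_mx11 !mxE /=.
rewrite addr0 expr0 expr1 mul1r mulN1r mulrN.
congr (M _ _ * M _ _ - M _ _ * M _ _); exact/val_inj.
Qed.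

(** Over the complex numbers the characteristic polynomial is (X - a)(X - b), so the trace is a + b
    and the determinant ab; the embedding of R preserves norms and order. *)
Lemma eigenvalues_lt1_bounds (R : rcfType) (M : 'M[R]_2) :
  (forall z : complex R, eigenvalue (map_mx (real_complex R) M) z -> `|z| < 1) ->
  `|\tr M| <= 2 /\ `|\det M| <= 1.
Proof.
move=> ev; set N := map_mx (real_complex R) M.
have normC (x : R) (y : R) : (`|real_complex R x| <= real_complex R y) = (`|x| <= y).
  by rewrite normc_def /= expr0n addr0 sqrtr_sqr lecR.
have [r Dp] := closed_field_poly_normal (char_poly N).
rewrite (monicP (char_poly_monic N)) scale1r in Dp.
have := size_char_poly N; rewrite Dp size_prod_XsubC.
case: r Dp => [|a [|b []]]//; rewrite !big_cons big_nil mulr1 => Dp _.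
have a1 : `|a| < 1 by apply: ev; rewrite eigenvalue_root_char Dp rootM root_XsubC eqxx.
have b1 : `|b| < 1.
  by apply: ev; rewrite eigenvalue_root_char Dp rootM !root_XsubC eqxx orbT.
have tN : \tr N = a + b.
  apply: oppr_inj; rewrite -(char_poly_trace N)// Dp /=.
  rewrite coefM !big_ord_recr big_ord0 /= !coefE /=. ring.
have dN : \det N = a * b.
  have := char_poly_det N; rewrite Dp expr2 mulrNN !mul1r => <-.
  by rewrite coef0M !coefE /= !add0r !mulrNN.
split.
  rewrite -normC -trace_map_mx tN rmorphMn rmorph1 -[2%:R]/(1 + 1).
  exact: le_trans (ler_normD _ _) (lerD (ltW a1) (ltW b1)).
rewrite -normC -det_map_mx dN rmorph1 normrM.
by rewrite mulr_ile1 ?normr_ge0// ltW.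
Qed.

(** * The leading form *)

Lemma coefM_top (R : comNzRingType) (p q : {poly R}) (k : nat) :
  (size p <= k.+1)%N -> (size q <= k.+1)%N -> (p * q)`_(k + k) = p`_k * q`_k.
Proof.
move=> pk qk; have kk : (k < (k + k).+1)%N by rewrite ltnS leq_addr.
rewrite coefM (bigD1 (Ordinal kk)) //= addnK big1 ?addr0// => j.
rewrite -val_eqE /= neq_ltn => /orP[jk|kj]; last first.
  by rewrite (nth_default _ (leq_trans pk kj)) mul0r.
by rewrite (@nth_default _ 0 q) ?mulr0// (leq_trans qk)// ltn_subRL ltn_add2r.
Qed.

(** Undoes the substitution y = 1. The degree n has to be kept apart, since for a = 0 the univariate
    polynomial is constant. *)
Lemma sum_coef_linear_power (R : comNzRingType) (a b x y : R) (n : nat) :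
  \sum_(j < n.+1) ((a *: 'X - b%:P) ^+ n)`_j * x ^+ j * y ^+ (n - j) =
  (a * x - b * y) ^+ n.
Proof.
have -> : (a *: 'X - b%:P) ^+ n =
    \poly_(j < n.+1) (((- b) ^+ (n - j) * a ^+ j) *+ 'C(n, j)).
  rewrite addrC -polyCN exprDn poly_def; apply: eq_bigr => j _.
  by rewrite exprZn -polyC_exp -scalerMnl -scalerA mul_polyC.
rewrite addrC -mulNr exprDn; apply: eq_bigr => j _.
by rewrite coef_poly ltn_ord !exprMn !mulrnAl; congr (_ *+ _); ring.
Qed.

(* With y = 1, the components of a homogeneous map (P, Q) of degree n become A
   and B, and the hypotheses say that its Jacobian has zero trace and zero
   determinant. *)
Lemma homogeneous_nilpotent (R : realFieldType) (A B : {poly R}) (n : nat) :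
  (A != 0) || (B != 0) ->
  A^`() + n%:R *: B - 'X * B^`() = 0 -> A^`() * B = A * B^`() ->
  exists c a b, [/\ c != 0, (a != 0) || (b != 0),
    A = (c * a) *: (b *: 'X - a%:P) ^+ n &
    B = (c * b) *: (b *: 'X - a%:P) ^+ n].
Proof.
have [->|B0 _ tr0 /wronskian_eq0-/(_ B0)[a Aa]] := eqVneq B 0.
  rewrite orbF => A0; rewrite deriv0 mulr0 scaler0 subr0 addr0 => A'0 _.
  have A1 : A = (A`_0)%:P.
    apply/size1_polyC; rewrite -subn_eq0 subn1 -size_deriv A'0.
    by rewrite size_poly0.
  (* Here w = (1, 0) and [b *: 'X - a%:P] is -1; the sign in c compensates its n-th power. *)
  exists ((-1) ^+ n * A`_0), 1, 0; split; rewrite ?oner_eq0//.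
  - rewrite mulf_neq0 ?signr_eq0//; apply: contraNneq A0.
    by rewrite A1 coefC /= => ->.
  - rewrite scale0r sub0r mulr1 {1}A1 -polyCN -polyC_exp -mul_polyC -polyCM.
    by rewrite mulrAC -exprMn mulrNN mulr1 expr1n mul1r.
  - by rewrite mulr0 scale0r.
(* With A = aB, the trace condition becomes the differential equation of $(X - a)^n$, so B and this
   power have zero Wronskian. *)
have XaB : B^`() * ('X - a%:P) = n%:R *: B.
  move: tr0; rewrite Aa derivZ => tr0; apply/eqP; rewrite -subr_eq0 -oppr_eq0.
  by rewrite -[X in _ == X]tr0 -!mul_polyC; apply/eqP; ring.
have Xa0 : ('X - a%:P) ^+ n != 0 by rewrite expf_neq0// polyXsubC_eq0.
have [|c Bc] := wronskian_eq0 (p := B) Xa0.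
  rewrite deriv_exp derivXsubC mul1r; case: n XaB {tr0 Xa0} => [|n] XaB.
    move/eqP: XaB; rewrite scale0r mulf_eq0 polyXsubC_eq0 orbF => /eqP ->.
    by rewrite mul0r mulr0n mulr0.
  by rewrite exprS mulrA XaB -scalerAl scaler_nat mulrnAr.
have c0 : c != 0 by apply: contraNneq B0; rewrite Bc => ->; rewrite scale0r.
by exists c, a, 1; rewrite oner_eq0 orbT scale1r mulr1 mulrC -scalerA -Bc -Aa.
Qed.

Lemma bivariate_coef_eventually0 (R : nzSemiRingType) (q : {poly {poly R}}) :
  exists N, forall j l, (N <= j + l)%N -> q`_j`_l = 0.
Proof.
exists (size q + \max_(j < size q) size (q`_j)%R)%N => j l N_le.
have [qj|jq] := leqP (size q) j; first by rewrite (nth_default 0 qj) coef0.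
rewrite [LHS]nth_default//.
apply: leq_trans (leq_bigmax (F := fun j : 'I_(size q) => size (q`_j)%R) (Ordinal jq)) _.
by rewrite -(leq_add2l (size q)) (leq_trans N_le)// leq_add2r ltnW.
Qed.

(** * Symmetries of a power of a linear form *)

Section CompactGroups.
Variable R : realType.
Implicit Types (g h : 'M[R]_2) (u v w : 'rV[R]_2).

Lemma bounded_natmul_le0 (x K : R) : (forall n, x *+ n <= K) -> x <= 0.
Proof.
move=> H; rewrite leNgt; apply/negP => x0.
have := H (Num.bound (K / x)); rewrite leNgt => /negP; apply.
rewrite -mulr_natl -ltr_pdivrMr//; apply: archi_boundP.
by rewrite divr_ge0 ?(ltW x0)//; exact: (H 0%N).
Qed.

(** Bernoulli's inequality $x^n \ge 1 + n(x - 1)$ bounds all multiples of x - 1. *)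
Lemma bounded_expr_le1 (x K : R) : 0 <= x -> (forall n, x ^+ n <= K) -> x <= 1.
Proof.
move=> x0 H; rewrite -subr_le0; apply: (@bounded_natmul_le0 _ (K - 1)) => n.
rewrite lerBrDl; apply: le_trans (H n).
elim: n => [|n IH]; first by rewrite addr0.
rewrite exprSr; apply: le_trans (ler_wpM2r x0 IH).
rewrite -[_ *+ n.+1]mulr_natl -[_ *+ n]mulr_natl -natr1.
(* The gap in the induction step is exactly $n(x-1)^2$. *)
have := mulr_ge0 (ler0n R n) (sqr_ge0 (x - 1)); nra.
Qed.

Lemma rV2_ext u v : u 0 0 = v 0 0 /\ u 0 1 = v 0 1 -> u = v.
Proof.
move=> [uv0 uv1]; apply/rowP => i; have [->//|i0] := eqVneq i 0.
suff -> : i = 1 by [].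
by apply/val_inj; case: i i0 => [[|[|]]].
Qed.

Lemma mxactM g h v : mxact (g *m h) v = mxact g (mxact h v).
Proof. by rewrite /mxact trmx_mul mulmxA. Qed.

Lemma mxact1 v : mxact 1%:M v = v.
Proof. by rewrite /mxact trmx1 mulmx1. Qed.

Lemma mxactD g u v : mxact g (u + v) = mxact g u + mxact g v.
Proof. exact: mulmxDl. Qed.

Lemma mxactZ g a v : mxact g (a *: v) = a *: mxact g v.
Proof. by rewrite /mxact scalemxAl. Qed.

Lemma mxact_eq1 g : (forall v, mxact g v = v) -> g = 1%:M.
Proof.
move=> gid; apply: trmx_inj; apply/row_matrixP => i.
by rewrite trmx1 !rowE [LHS]gid mulmx1.
Qed.

Lemma compact_mxact_bounded (G : set 'M[R]_2) v :
  compact G -> exists K, forall g, G g -> forall i, `|mxact g v 0 i| <= K.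
Proof.
move=> /compact_bounded[M [_ HM]].
(* [compact_bounded] bounds the norm only by numbers strictly above M, hence M + 1. *)
exists ((M + 1) * `|v 0 0| + (M + 1) * `|v 0 1|) => g Gg i.
have gM a b : `|g a b| <= M + 1.
  apply: le_trans (HM (M + 1) _ g Gg); last by rewrite ltrDl.
  rewrite [leRHS]mx_normrE.
  exact: (le_bigmax _ (fun ij : 'I_2 * 'I_2 => `|g ij.1 ij.2|) (a, b)).
rewrite /mxact mxE !big_ord_recl big_ord0 addr0 !mxE.
rewrite (le_trans (ler_normD _ _))// !normrM.
rewrite (_ : lift ord0 ord0 = 1 :> 'I_2); last exact/val_inj.
by apply: lerD; rewrite mulrC ler_wpM2r.
Qed.

Variables (G : set 'M[R]_2) (w : 'rV[R]_2) (m : nat).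
Hypotheses (Ggroup : GL2_subgroup G) (Gcompact : compact G) (w0 : w != 0).

(** The determinant of the pair (v, w): a linear form whose kernel is the line of w. *)
Let ell v := w 0 1 * v 0 0 - w 0 0 * v 0 1.

(* The equivariance of [fun v => ell v ^+ m *: w]. *)
Hypothesis Gw : forall g, G g -> forall v,
  ell (mxact g v) ^+ m *: w = ell v ^+ m *: mxact g w.

Let G1 : G 1%:M. Proof. by have [] := Ggroup. Qed.
Let GM g h : G g -> G h -> G (g *m h).
Proof. by have [_ _ + _] := Ggroup; apply. Qed.
Let GV g : G g -> G (invmx g).
Proof. by have [_ _ _] := Ggroup; apply. Qed.

Let ellD u v : ell (u + v) = ell u + ell v.
Proof. by rewrite /ell !mxE; ring. Qed.
Let ellZ a v : ell (a *: v) = a * ell v.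
Proof. by rewrite /ell !mxE; ring. Qed.
Let ellw : ell w = 0.
Proof. by rewrite /ell mulrC subrr. Qed.

Let q := w 0 0 ^+ 2 + w 0 1 ^+ 2.
Let q0 : q != 0.
Proof.
apply: contraNneq w0 => /eqP; rewrite paddr_eq0 ?sqr_ge0// !sqrf_eq0.
by move=> /andP[/eqP a /eqP b]; apply/eqP/rV2_ext; rewrite !mxE.
Qed.

(** A quarter turn of w, scaled so that [ell e] is 1; e and w form an orthogonal basis. *)
Let e : 'rV[R]_2 := q^-1 *: \row_i (if i == 0 then w 0 1 else - w 0 0).
Let elle : ell e = 1.
Proof.
by rewrite /e ellZ /ell !mxE /= mulrN opprK -!expr2 addrC mulVf.
Qed.

Let decomp v : exists t, v = ell v *: e + t *: w.
Proof.
exists (q^-1 * (v 0 0 * w 0 0 + v 0 1 * w 0 1)); move: q0; rewrite /e /ell /q => qn0.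
by apply/rV2_ext; rewrite !mxE /=; split; field.
Qed.

(** In the basis (e, w), an element g of G is triangular with diagonal entries [nu g] and
    [nu g ^+ m]. *)
Let nu g := ell (mxact g e).

Let actw g : G g -> mxact g w = nu g ^+ m *: w.
Proof. by move=> /Gw/(_ e); rewrite elle expr1n scale1r. Qed.

(** As g preserves the line of w, the form [ell] composed with g vanishes on w, so its value at e
    determines it. *)
Let ell_act g v : G g -> ell (mxact g v) = nu g * ell v.
Proof.
move=> Gg; have [t {1}->] := decomp v.
rewrite mxactD (mxactZ _ _ e) mxactZ actw// ellD !ellZ ellw.
by rewrite !mulr0 addr0 mulrC.
Qed.

Let nuM g h : G g -> G h -> nu (g *m h) = nu g * nu h.
Proof. by move=> Gg Gh; rewrite /nu mxactM ell_act. Qed.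

Let GX g n : G g -> G (g ^+ n).
Proof. by move=> Gg; elim: n => [|n IH]; rewrite ?exprS; [exact: G1|exact: GM]. Qed.

Let nuX g n : G g -> nu (g ^+ n) = nu g ^+ n.
Proof.
move=> Gg; elim: n => [|n IH]; first by rewrite /nu [mxact _ _]mxact1 elle.
by rewrite !exprS nuM ?IH//; exact: GX.
Qed.

(** The powers of [nu g] are values of [nu] on G, which compactness bounds. *)
Let nu_le1 g : G g -> `|nu g| <= 1.
Proof.
move=> Gg; have [K HK] := compact_mxact_bounded e Gcompact.
apply: (@bounded_expr_le1 _ (`|w 0 1| * K + `|w 0 0| * K)) => // n.
rewrite -normrX -nuX// /nu /ell (le_trans (ler_normB _ _))// !normrM.
by apply: lerD; rewrite ler_wpM2l// HK//; exact: GX.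
Qed.

Let nu_norm g : G g -> `|nu g| = 1.
Proof.
move=> Gg; apply/eqP; rewrite eq_le nu_le1//=.
have gu : g \in unitmx by have [+ _ _ _] := Ggroup; apply.
have := nuM (GV Gg) Gg; rewrite mulVmx// /nu mxact1 elle -/(nu _) -/(nu g).
move=> /(congr1 Num.norm); rewrite normr1 normrM => ->.
by rewrite ler_piMl// nu_le1//; exact: GV.
Qed.

(** Such a g fixes w and sends e to e + tw, so $g^n e = e + n t w$; boundedness of these vectors
    forces tw = 0. *)
Let nu_eq1 g : G g -> nu g = 1 -> g = 1%:M.
Proof.
move=> Gg g1; have gw : mxact g w = w by rewrite actw// g1 expr1n scale1r.
have [t] := decomp (mxact g e); rewrite -/(nu g) g1 scale1r => ge.
have gX n : mxact (g ^+ n) e = e + (t *: w) *+ n.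
  elim: n => [|n IH]; first by rewrite [LHS]mxact1 addr0.
  rewrite exprS [LHS]mxactM IH mxactD ge -scaler_nat !mxactZ gw.
  by rewrite mulrS scaler_nat addrA.
have [K HK] := compact_mxact_bounded e Gcompact.
have tw : t *: w = 0.
  apply/rowP => i; rewrite [RHS]mxE.
  apply/eqP; rewrite -normr_le0; apply: (@bounded_natmul_le0 _ (K + `|e 0 i|)).
  move=> n; rewrite -normrMn.
  have -> : (t *: w) 0 i *+ n = mxact (g ^+ n) e 0 i - e 0 i.
    by rewrite gX [X in _ = X - _]mxE addrAC subrr add0r mulmxnE.
  by rewrite (le_trans (ler_normB _ _))// lerD2r HK//; exact: GX.
apply: mxact_eq1 => v; have [s ->] := decomp v.
by rewrite mxactD (mxactZ _ _ e) mxactZ gw ge tw addr0.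
Qed.

(** Nontrivial elements have [nu] equal to -1, so the product of any two of them is the identity,
    and g = g(hh) = (gh)h = h. *)
Lemma line_power_symmetries g h :
  G g -> G h -> g <> 1%:M -> h <> 1%:M -> g = h.
Proof.
have nuN1 k : G k -> k <> 1%:M -> nu k = -1.
  move=> Gk k1; have /eqP := nu_norm Gk; rewrite eqr_norml ler01 andbT.
  by case/orP => /eqP// /(nu_eq1 Gk).
have mul1 k l : G k -> G l -> k <> 1%:M -> l <> 1%:M -> k *m l = 1%:M.
  move=> Gk Gl k1 l1; apply: nu_eq1; first exact: GM.
  by rewrite nuM// !nuN1// mulrNN mulr1.
move=> Gg Gh g1 h1.
by rewrite -[g]mulmx1 -(mul1 h h)// mulmxA (mul1 g h)// mul1mx.
Qed.

End CompactGroups.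

(** * Symmetries and leading form of a polynomial map *)

Section LeadingForm.
Variables (R : realType) (F : 'rV[R]_2 -> 'rV[R]_2).
Variable p : 'I_2 -> {poly {poly R}}.
Hypothesis Fp : forall v i, F v 0 i = (p i).[(v 0 0)%:P].[v 0 1].

(** Linearity of g makes equivariance at tv an identity of polynomials in t; the coefficients of
    $t^k$ are compared. *)
Lemma homog_part_equivariant (g : 'M[R]_2) (k : nat) (v : 'rV[R]_2) :
  (forall u, F (mxact g u) = mxact g (F u)) ->
  \row_i homog_part (p i) k (mxact g v 0 0) (mxact g v 0 1) =
  mxact g (\row_i homog_part (p i) k (v 0 0) (v 0 1)).
Proof.
move=> Fg; apply/rowP => i; rewrite mxE [RHS]mxE -coef_ray.
have -> : ray_poly (p i) (mxact g v 0 0) (mxact g v 0 1) =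
    \sum_j (g i j) *: ray_poly (p j) (v 0 0) (v 0 1).
  apply: poly_ext => t; rewrite horner_ray horner_sum.
  have := congr1 (fun u : 'rV[R]_2 => u 0 i) (Fg (t *: v)).
  rewrite Fp mxactZ !mxE => ->; apply: eq_bigr => j _.
  by rewrite Fp !mxE hornerZ horner_ray mulrC.
rewrite coef_sum; apply: eq_bigr => j _.
by rewrite coefZ coef_ray !mxE mulrC.
Qed.

Lemma linear_polynomial_map :
  (forall i j l, (2 <= j + l)%N -> (p i)`_j`_l = 0) -> F 0 = 0 -> linear F.
Proof.
move=> p2 F0.
have FE v i : F v 0 i = (p i)`_0`_1 * v 0 1 + (p i)`_1`_0 * v 0 0.
  rewrite Fp -[v 0 0 in LHS]mul1r -[v 0 1 in LHS]mul1r -horner_ray.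
  rewrite (@horner_coef_wide _ 2); last first.
    apply/leq_sizeP => j j2; rewrite coef_ray /homog_part big1// => l _.
    by rewrite p2 ?mul0r// subnKC// -ltnS.
  rewrite !big_ord_recl big_ord0 !coef_ray /homog_part !big_ord_recl !big_ord0 /=.
  have -> : (p i)`_0`_0 = 0.
    have := congr1 (fun u : 'rV[R]_2 => u 0 i) F0.
    by rewrite Fp !mxE -!horner_coef0.
  by rewrite !expr0 !expr1 /=; ring.
move=> a u v; apply/rowP => i; rewrite !mxE !FE !mxE; ring.
Qed.

(** The top degree is written k + 1, so on each ray the Jacobian entries have degree at most k in t,
    and their coefficients of $t^k$ come from the top form. *)
Lemma leading_form (k : nat) :
  jacobian_eigenvalues_lt1 F -> (0 < k)%N ->
  (forall i j l, (k.+1 < j + l)%N -> (p i)`_j`_l = 0) ->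
  (exists i j l, (j + l = k.+1)%N /\ (p i)`_j`_l <> 0) ->
  exists c (w : 'rV[R]_2), [/\ c != 0, w != 0 & forall i x y,
    homog_part (p i) k.+1 x y =
    c * w 0 i * (w 0 1 * x - w 0 0 * y) ^+ k.+1].
Proof.
move=> ev k0 pk p0.
(* The i-th component of the top form at (x, 1). *)
pose A i := \poly_(j < k.+2) (p i)`_j`_(k.+1 - j).
pose dx i x := ray_poly (p i)^`() x 1.
pose dy i x := ray_poly (map_poly (@deriv R) (p i)) x 1.
have dxk i x : (dx i x)`_k = (A i)^`().[x].
  by rewrite coef_ray homog_part_deriv_fst.
have dyk i x : (dy i x)`_k = k.+1%:R * (A i).[x] - x * (A i)^`().[x].
  by rewrite coef_ray homog_part_deriv_snd.
have sdx i x : (size (dx i x) <= k.+1)%N.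
  apply/leq_sizeP => j jk; rewrite coef_ray /homog_part big1// => l _.
  rewrite coef_deriv coefMn pk ?mul0rn ?mul0r//.
  by rewrite addSn subnKC ?ltnS // -ltnS.
have sdy i x : (size (dy i x) <= k.+1)%N.
  apply/leq_sizeP => j jk; rewrite coef_ray /homog_part big1// => l _.
  rewrite coef_map_id0 ?linear0// coef_deriv pk ?mul0rn ?mul0r//.
  by rewrite addnS subnKC ?ltnS // -ltnS.
pose v x t : 'rV[R]_2 := t *: \row_i (if i == 0 then x else 1).
have J0 x t i : jacobian F (v x t) 0 i = (dx i x).[t].
  by rewrite (jacobian_polynomial_map_fst Fp) horner_ray !mxE.
have J1 x t i : jacobian F (v x t) 1 i = (dy i x).[t].
  by rewrite (jacobian_polynomial_map_snd Fp) horner_ray !mxE.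
have tr_const x : (size (dx 0 x + dy 1 x)%R <= 1)%N.
  apply: (@bounded_poly_size _ _ 2) => t.
  have [+ _] := eigenvalues_lt1_bounds (ev (v x t)).
  rewrite /mxtrace !big_ord_recl big_ord0 addr0.
  by rewrite (_ : lift ord0 ord0 = 1); [rewrite J0 J1 hornerD|exact/val_inj].
have det_const x : (size (dx 0 x * dy 1 x - dx 1 x * dy 0 x)%R <= 1)%N.
  apply: (@bounded_poly_size _ _ 1) => t.
  have [_] := eigenvalues_lt1_bounds (ev (v x t)).
  by rewrite det_mx22 !J0 !J1 !hornerE.
(* Since k > 0, a constant polynomial in t has no term of degree k; for the determinant the degree
   is 2k. *)
have trA x : (A 0)^`().[x] + (k.+1%:R * (A 1).[x] - x * (A 1)^`().[x]) = 0.
  by rewrite -dxk -dyk -coefD nth_default// (leq_trans (tr_const x)).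
have detA x : (A 0)^`().[x] * (A 1).[x] = (A 0).[x] * (A 1)^`().[x].
  have kk : (1 <= k + k)%N by rewrite addn_gt0 k0.
  have := nth_default 0 (leq_trans (det_const x) kk).
  rewrite coefB !coefM_top// !dxk !dyk => D.
  (* After Euler's identity the terms with factor x cancel in the determinant, leaving k + 1 times
     the Wronskian. *)
  have k1 : k.+1%:R != 0 :> R by rewrite pnatr_eq0.
  by apply: (mulfI k1); apply/eqP; rewrite -subr_eq0 -[X in _ == X]D; apply/eqP; ring.
have [|||c [a [b [c0 ab A0 A1]]]] := @homogeneous_nilpotent _ (A 0) (A 1) k.+1.
- rewrite -negb_and; apply/negP => /andP[/eqP A0 /eqP A1].
  have [i [j [l [jl]]]] := p0; apply.
  have -> : (p i)`_j`_l = (A i)`_j.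
    by rewrite coef_poly ltnS -jl leq_addr addKn.
  have [->|i0] := eqVneq i 0; first by rewrite A0 coef0.
  by rewrite (_ : i = 1) ?A1 ?coef0//; apply/val_inj; case: i i0 => [[|[|]]].
- by apply: poly_ext => x; rewrite !hornerE -[RHS](trA x) addrA.
- by apply: poly_ext => x; rewrite !hornerE detA.
exists c, (\row_i (if i == 0 then a else b)); split=> //.
  apply: contraTneq ab => /rowP w0; have := w0 0; have := w0 1.
  by rewrite !mxE /= => -> ->; rewrite eqxx.
move=> i x y; rewrite !mxE/= -sum_coef_linear_power mulr_sumr.
apply: eq_bigr => j _.
have -> : (p i)`_j`_(k.+1 - j) = (A i)`_j by rewrite coef_poly ltn_ord.
have [->|i0] := eqVneq i 0; first by rewrite A0 coefZ !mulrA.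
rewrite (_ : i = 1); first by rewrite A1 coefZ !mulrA.
by apply/val_inj; case: i i0 => [[|[|]]].
Qed.

End LeadingForm.

(** * The order of the symmetry group *)

Theorem theorem3p2 (R : realType) (F : 'rV[R]_2 -> 'rV[R]_2)
    (G : set 'M[R]_2) :
  polynomial_map F ->
  ~ linear F ->
  F 0 = 0 ->
  jacobian_eigenvalues_lt1 F ->
  symmetry_group F G ->
  G <> [set 1%:M] ->
  (G #= `I_2)%card.
Proof.
move=> [p Fp] nlin F0 ev [[Ggrp Gcpt Geq] _] Gn1.
(* A boolean predicate, so that [ex_minnP] gives the least such N; the degree of F is then N - 1. *)
pose vanish N := `[< forall i j l, (N <= j + l)%N -> (p i)`_j`_l = 0 >].
have : exists N, vanish N.
  have [N0 H0] := bivariate_coef_eventually0 (p 0).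
  have [N1 H1] := bivariate_coef_eventually0 (p 1).
  exists (maxn N0 N1); apply/asboolP => i j l; rewrite geq_max => /andP[l0 l1].
  have [->|i0] := eqVneq i 0; first exact: H0.
  by rewrite (_ : i = 1); [exact: H1|apply/val_inj; case: i i0 => [[|[|]]]].
case/ex_minnP => N /asboolP pN Nmin.
have N2 : (2 < N)%N.
  rewrite ltnNge; apply/negP => N2; apply: nlin.
  apply: (linear_polynomial_map Fp) => // i j l jl.
  by rewrite pN// (leq_trans N2).
(* Now N = k + 2 with k > 0, so the top degree is k + 1; minimality of N provides a nonzero
   coefficient there. *)
case: N N2 pN Nmin => [|[|k]]// k0 pk kmin.
have [|c [w [c0 w0 pE]]] := leading_form Fp ev k0 pk.
  apply: contrapT => H; suff /kmin : vanish k.+1 by rewrite ltnn.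
  apply/asboolP => i j l; rewrite leq_eqVlt => /orP[/eqP jl|]; last exact: pk.
  by apply: contrapT => pijl; apply: H; exists i, j, l.
have Gw g : G g -> forall v,
    (w 0 1 * mxact g v 0 0 - w 0 0 * mxact g v 0 1) ^+ k.+1 *: w =
    (w 0 1 * v 0 0 - w 0 0 * v 0 1) ^+ k.+1 *: mxact g w.
  move=> Gg v; have := homog_part_equivariant Fp k.+1 v (Geq g Gg).
  have rowE u : \row_i homog_part (p i) k.+1 (u 0 0) (u 0 1) =
      c *: ((w 0 1 * u 0 0 - w 0 0 * u 0 1) ^+ k.+1 *: w) :> 'rV[R]_2.
    by apply/rowP => i; rewrite !mxE pE; ring.
  by rewrite !rowE !mxactZ => /(scalerI c0).
have [g Gg g1] : exists2 g, G g & g <> 1%:M.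
  apply: contrapT => H; apply: Gn1; apply/seteqP; split=> [g Gg|_ ->].
    by apply: contrapT => g1; apply: H; exists g.
  by have [] := Ggrp.
(* Removing the identity from G must leave exactly one element. *)
apply/eq_cardSP; exists 1%:M; first by have [] := Ggrp.
rewrite (_ : G `\ 1%:M = [set g]); first exact: card_set1.
apply/seteqP; split=> [h [Gh h1]|_ ->]; last by split.
exact: (line_power_symmetries Ggrp Gcpt w0 Gw).
Qed.
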